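(* Let $\{X_n\}_{n\in\mathbb{N}}$ and $\{Y_n\}_{n\in\mathbb{N}}$ be sequences of integer valued random variables for which there exist a sequence $\{Z_n\}_{n\in\mathbb{N}}$ of random elements and two integer valued random variables $X$ and $Y$ such that $(X_n,Y_n)$ converges in distribution to $(X,Y)$ conditioned on $Z_n$, i.e. for every bounded continuous $h:\mathbb{R}^2\to\mathbb{R}$, $\mathbb{E}[h(X_n,Y_n)\mid Z_n]\to\mathbb{E}[h(X,Y)]$ in probability as $n\to\infty$. Then, as $n\to\infty$, (i) $3\,\mathbb{E}\left[\mathcal{F}_{X_n|Z_n}(X_n)\,\mathcal{F}_{Y_n|Z_n}(Y_n)\,\middle|\,Z_n\right]-3\to\rho(X,Y)$ in probability, and (ii) $\mathbb{E}\left[\mathcal{H}_{X_n,Y_n|Z_n}(X_n,Y_n)\,\middle|\,Z_n\right]-1\to\tau(X,Y)$ in probability. Moreover, (iii) $\lim_{n\to\infty}3\,\mathbb{E}\left[\mathcal{F}_{X_n|Z_n}(X_n)\,\mathcal{F}_{Y_n|Z_n}(Y_n)\right]-3=\rho(X,Y)$, and (iv) $\lim_{n\to\infty}\mathbb{E}\left[\mathcal{H}_{X_n,Y_n|Z_n}(X_n,Y_n)\right]-1=\tau(X,Y)$.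
   Context: For each $n$, $X_n,Y_n,Z_n$ are defined on a common probability space. For a random variable $X$, $F_X$ is its distribution function; $H_{X,Y}$ is the joint distribution function of $(X,Y)$. For integer valued $X,Y$ and $k,l\in\mathbb{Z}$ put $\mathcal{F}_X(k)=F_X(k)+F_X(k-1)$ and $\mathcal{H}_{X,Y}(k,l)=H_{X,Y}(k,l)+H_{X,Y}(k-1,l)+H_{X,Y}(k,l-1)+H_{X,Y}(k-1,l-1)$. For a random element $Z$, $F_{X|Z}(x)=\mathbb{P}(X\le x\mid Z)$ and $H_{X,Y|Z}(x,y)=\mathbb{P}(X\le x,Y\le y\mid Z)$ (random functions $F_{X|Z}(x,\omega)$, $H_{X,Y|Z}(x,y,\omega)$), and, for integer valued $X,Y$ and $k,l\in\mathbb{Z}$, $\mathcal{F}_{X|Z}(k)=F_{X|Z}(k)+F_{X|Z}(k-1)$ and $\mathcal{H}_{X,Y|Z}(k,l)=H_{X,Y|Z}(k,l)+H_{X,Y|Z}(k-1,l)+H_{X,Y|Z}(k,l-1)+H_{X,Y|Z}(k-1,l-1)$. The random variable $\mathcal{F}_{X|Z}(X)$ is $\omega\mapsto\mathcal{F}_{X|Z}(X(\omega),\omega)$, and $\mathcal{H}_{X,Y|Z}(X,Y)$ is $\omega\mapsto\mathcal{H}_{X,Y|Z}(X(\omega),Y(\omega),\omega)$. For integer valued random variables $X,Y$, Spearman's rho is $\rho(X,Y)=3\big(\mathbb{P}(X<X',Y<Y'')+\mathbb{P}(X\le X',Y<Y'')+\mathbb{P}(X<X',Y\le Y'')+\mathbb{P}(X\le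 X',Y\le Y'')-1\big)$, where $(X',Y')$ and $(X'',Y'')$ are independent copies of $(X,Y)$ (equivalently $\rho(X,Y)=3\,\mathbb{E}[\mathcal{F}_X(X)\mathcal{F}_Y(Y)]-3$), and Kendall's tau is $\tau(X,Y)=\mathbb{E}[\mathcal{H}_{X,Y}(X,Y)]-1$. *)

(* Defs.v *)
From mathcomp Require Export all_boot all_order all_algebra.
From mathcomp Require Export all_classical all_reals all_analysis.
Export Order.TTheory GRing.Theory Num.Theory.
Export numFieldNormedType.Exports.

Set Implicit Arguments.
Unset Strict Implicit.
Unset Printing Implicit Defensive.

Local Open Scope classical_set_scope.
Local Open Scope ring_scope.

(* Integer valued random variables are real random variables all of whose
   values are integers, so that the real cdf's and continuous test functions
   on the plane apply to them without a cast. *)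
Definition integer_valued (T : Type) (R : realType) (X : T -> R) :=
  forall t, X t \is a Num.int.

(* [condE_version P Z f g]: the function g is a version of the conditional
   expectation E[f | Z], for f integrable.  [preimage_set_system setT Z measurable]
   is the sigma-algebra sigma(Z). *)
Definition condE_version (R : realType) (d d' : measure_display)
    (T : measurableType d) (E : measurableType d') (P : probability T R)
    (Z : {RV P >-> E}) (f g : T -> R) :=
  let sigmaZ := preimage_set_system setT Z measurable in
  [/\ forall B : set R, measurable B -> sigmaZ (g @^-1` B),
      P.-integrable setT (EFin \o g) &
      forall A, sigmaZ A ->
        (\int[P]_(t in A) (g t)%:E = \int[P]_(t in A) (f t)%:E)%E].

(* The random functions F_{X|Z}(x, w) and H_{X,Y|Z}(x, y, w): a version is
   fixed separately at each point. *)
Definition cond_cdf_version (R : realType) (d d' : measure_display)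
    (T : measurableType d) (E : measurableType d') (P : probability T R)
    (Z : {RV P >-> E}) (X : T -> R) (F : R -> T -> R) :=
  forall x, condE_version Z (\1_[set t | X t <= x]) (F x).

Definition cond_joint_cdf_version (R : realType) (d d' : measure_display)
    (T : measurableType d) (E : measurableType d') (P : probability T R)
    (Z : {RV P >-> E}) (X Y : T -> R) (H : R -> R -> T -> R) :=
  forall x y, condE_version Z (\1_[set t | X t <= x /\ Y t <= y]) (H x y).

Definition calF (R : realType) (F : R -> R) (k : R) : R := F k + F (k - 1).

Definition calH (R : realType) (H : R -> R -> R) (k l : R) : R :=
  H k l + H (k - 1) l + H k (l - 1) + H (k - 1) (l - 1).

(* The random variables w |-> calF_{X|Z}(X(w), w) and
   w |-> calH_{X,Y|Z}(X(w), Y(w), w). *)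
Definition calF_at (T : Type) (R : realType) (F : R -> T -> R) (X : T -> R)
    (t : T) : R :=
  calF (F ^~ t) (X t).

Definition calH_at (T : Type) (R : realType) (H : R -> R -> T -> R)
    (X Y : T -> R) (t : T) : R :=
  calH (fun x y => H x y t) (X t) (Y t).

Definition joint_cdf (R : realType) (d : measure_display)
    (T : measurableType d) (P : probability T R) (X Y : {RV P >-> R})
    (x y : R) : R :=
  fine (P [set t | X t <= x /\ Y t <= y]).

(* The independent copies (X', Y') and (X'', Y'') of (X, Y) are realised on the
   threefold product space: (X, Y) is read at w.1, (X', Y') at w.2.1 and
   (X'', Y'') at w.2.2. *)
Definition spearman_rho (R : realType) (d : measure_display)
    (T : measurableType d) (P : probability T R) (X Y : {RV P >-> R}) : R :=
  let Pr (A : set (T * (T * T))) := fine ((P \x (P \x P))%E A) in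
  3 * (Pr [set w | X w.1 < X w.2.1 /\ Y w.1 < Y w.2.2] +
       Pr [set w | X w.1 <= X w.2.1 /\ Y w.1 < Y w.2.2] +
       Pr [set w | X w.1 < X w.2.1 /\ Y w.1 <= Y w.2.2] +
       Pr [set w | X w.1 <= X w.2.1 /\ Y w.1 <= Y w.2.2] - 1).

Definition kendall_tau (R : realType) (d : measure_display)
    (T : measurableType d) (P : probability T R) (X Y : {RV P >-> R}) : R :=
  fine ('E_P[fun t => calH (joint_cdf X Y) (X t) (Y t)])%E - 1.

(* Each U n lives on its own probability space. *)
Definition cvg_in_probability (R : realType) (d : nat -> measure_display)
    (T : forall n, measurableType (d n)) (P : forall n, probability (T n) R)
    (U : forall n, T n -> R) (c : R) :=
  forall eps : R, 0 < eps ->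
    P n [set t | eps < `|U n t - c|] @[n --> \oo] --> 0%E.

(* Conditional convergence in distribution of (X_n, Y_n) given Z_n; since
   versions of a conditional expectation agree almost surely, the choice of
   version is immaterial for convergence in probability. *)
Definition cvg_in_distribution_given (R : realType) (d d' : nat -> measure_display)
    (T : forall n, measurableType (d n)) (E : forall n, measurableType (d' n))
    (P : forall n, probability (T n) R)
    (X Y : forall n, {RV P n >-> R}) (Z : forall n, {RV P n >-> E n})
    (d0 : measure_display) (T0 : measurableType d0) (P0 : probability T0 R)
    (X0 Y0 : {RV P0 >-> R}) :=
  forall h : R * R -> R, continuous h -> (exists M, forall p, `|h p| <= M) ->
  exists g : forall n, T n -> R,
    (forall n, condE_version (Z n) (fun t => h (X n t, Y n t)) (g n)) /\
    cvg_in_probability P g (fine ('E_P0[fun t => h (X0 t, Y0 t)])%E).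

(* Main.v *)
Require Import Defs.
From mathcomp Require Import measurable_realfun zify ring lra.

Set Implicit Arguments.
Unset Strict Implicit.
Unset Printing Implicit Defensive.

Local Open Scope classical_set_scope.
Local Open Scope ring_scope.

(* Replacing the indicator of [x <= a] by the Lipschitz function
   [step a x = min 1 (max 0 (a + 1 - x))], which agrees with it at integers,
   makes everything continuous: the conditional cdfs become conditional
   expectations of admissible test functions, and the limit functions
   a |-> E[step a X] (resp. (a, b) |-> E[step a X * step b Y]) are bounded
   continuous interpolations of the limit cdfs.  Hence, with Phi such a limit
   function and G_n(k, l) the corresponding version, E|G_n(k, l) - Phi(k, l)|
   tends to 0 for each (k, l); as the tails of (X_n, Y_n) are controlled by one
   more test function, E|G_n(X_n, Y_n) - Phi(X_n, Y_n)| tends to 0 too.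
   Since conditional expectation contracts the L1 norm, it remains to apply the
   hypothesis to the test function h built from Phi, whose mean under (X, Y) is
   the rank correlation of the limit. *)

(** * Conditional expectations *)

Section condE.
Context (R : realType) (d d' : measure_display) (T : measurableType d)
  (E : measurableType d') (P : probability T R) (Z : {RV P >-> E}).
Implicit Types (f g u v : T -> R) (A : set T).

Let sigmaZ : set (set T) := preimage_set_system setT Z measurable.

Lemma sigma_RV_algebra : sigma_algebra setT sigmaZ.
Proof. exact/sigma_algebra_preimage/sigma_algebra_measurable. Qed.

Lemma sigma_RV_measurable A : sigmaZ A -> measurable A.
Proof. by case=> B mB <-; exact: (@measurable_funPT _ _ _ _ Z). Qed.

Lemma condE_measurable f u : condE_version Z f u -> measurable_fun setT u.
Proof.
by case=> um _ _ _ B mB; rewrite setTI; apply: sigma_RV_measurable; exact: um.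
Qed.

(** Compared with other versions through [condE_ae_le], constant versions carry bounds on a function
    over to its conditional expectation. *)
Lemma condE_cst (c : R) : condE_version Z (cst c) (cst c).
Proof.
split => // [B mB|]; last exact: finite_measure_integrable_cst.
exists (if c \in B then setT else set0).
  by case: ifP.
rewrite setTI; case: ifPn => cB; apply/seteqP; split => t //=.
- by rewrite inE in cB.
- by rewrite notin_setE in cB.
Qed.

(** Membership in sigma(Z), not mere measurability, matters: versions share the integrals of the
    original functions only over events of sigma(Z). The event is the union over rationals [q] of
    the events [u < q < v]. *)
Lemma condE_lt f g u v : condE_version Z f u -> condE_version Z g v ->
  sigmaZ [set t | u t < v t].
Proof.
move=> [um _ _] [vm _ _]; have [s0 sC sU] := sigma_RV_algebra.
have sI A B : sigmaZ A -> sigmaZ B -> sigmaZ (A `&` B).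
  move=> [A' mA' <-] [B' mB' <-]; exists (A' `&` B'); first exact: measurableI.
  by rewrite !setTI preimage_setI.
(* Rationals are enumerated by [unpickle]; an index that decodes to none contributes the empty
   set. *)
rewrite (_ : [set t | _] = \bigcup_n
    (if unpickle n is Some q then
      [set t | u t < ratr q] `&` [set t | ratr q < v t] else set0)).
  apply: sU => n; case: unpickle => [q|]; last exact: s0.
  apply: sI.
    rewrite (_ : [set t | _] = u @^-1` [set` `]-oo, ratr q[]).
      exact: um.
    by apply/seteqP; split => t /=; rewrite in_itv.
  rewrite (_ : [set t | _] = v @^-1` [set` `]ratr q, +oo[]).
    exact: vm.
  by apply/seteqP; split => t /=; rewrite in_itv/= andbT.
apply/seteqP; split=> t /=.
  move=> /rat_in_itvoo[q]; rewrite in_itv/= => /andP[uq qv].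
  by exists (pickle q); [exact: I|rewrite pickleK].
by move=> [n _]; case: unpickle => [q|//] [/= + +]; exact: lt_trans.
Qed.

Lemma condE_integralB f g u v A : condE_version Z f u -> condE_version Z g v ->
  P.-integrable setT (EFin \o f) -> P.-integrable setT (EFin \o g) ->
  sigmaZ A ->
  (\int[P]_(t in A) (u t - v t)%:E = \int[P]_(t in A) (f t - g t)%:E)%E.
Proof.
move=> [_ iu ufE] [_ iv vgE] iF ig sA.
have mA := sigma_RV_measurable sA.
have sub h : P.-integrable setT (EFin \o h) -> P.-integrable A (EFin \o h).
  by apply: integrableS.
under eq_integral do rewrite EFinB.
under [RHS]eq_integral do rewrite EFinB.
by rewrite !integralB_EFin ?ufE ?vgE//; exact: sub.
Qed.

(* On the event [u < v] and on its complement, both in sigma(Z), the sign of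
   [u - v] is constant, so that |u - v| integrates to the integral of
   [+- (f - g)]. *)
Lemma condE_contraction f g u v :
  condE_version Z f u -> condE_version Z g v ->
  P.-integrable setT (EFin \o f) -> P.-integrable setT (EFin \o g) ->
  (\int[P]_t `|u t - v t|%:E <= \int[P]_t `|f t - g t|%:E)%E.
Proof.
move=> hu hv iF ig.
have sA := condE_lt hu hv; set A := [set t | _] in sA.
have mA := sigma_RV_measurable sA.
have sAC : sigmaZ (~` A) by have [_ + _] := sigma_RV_algebra; rewrite -setTD; exact.
have mAC := sigma_RV_measurable sAC.
have mu := condE_measurable hu; have mv := condE_measurable hv.
have mf : measurable_fun setT f by move/integrableP : iF => -[/measurable_EFinP].
have mg : measurable_fun setT g by move/integrableP : ig => -[/measurable_EFinP].
have mN (h k : T -> R) (B : set T) : measurable_fun setT h ->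
    measurable_fun setT k -> measurable_fun B (fun t => `|h t - k t|%:E).
  move=> mh mk; apply: (@measurable_funS _ _ _ _ setT) => //.
  by apply/measurable_EFinP; apply: measurableT_comp => //; exact: measurable_funB.
have split_ (h k : T -> R) : measurable_fun setT h -> measurable_fun setT k ->
    (\int[P]_t `|h t - k t|%:E =
     \int[P]_(t in A) `|h t - k t|%:E + \int[P]_(t in ~` A) `|h t - k t|%:E)%E.
  move=> mh mk; rewrite -ge0_integral_setU//.
  - by rewrite setUv.
  - exact: mN.
  - by rewrite disj_set2E setICr.
have le_ (h k : T -> R) (B : set T) : measurable B -> measurable_fun setT h ->
    measurable_fun setT k ->
    (\int[P]_(t in B) (h t - k t)%:E <= \int[P]_(t in B) `|h t - k t|%:E)%E.
  move=> mB mh mk; apply: le_trans (lee_abs _) _.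
  apply: le_trans (le_abse_integral _ _ _) _ => //.
  apply: (@measurable_funS _ _ _ _ setT) => //.
  by apply/measurable_EFinP; exact: measurable_funB.
rewrite split_// [leRHS]split_//; apply: leeD.
- rewrite [leLHS](_ : _ = \int[P]_(t in A) (v t - u t)%:E)%E.
    rewrite (condE_integralB hv hu)//; apply: le_trans (le_ _ _ _ _ _ _) _ => //.
    by under eq_integral do rewrite distrC.
  apply: eq_integral => t; rewrite inE /A/= => uv.
  by rewrite ltr0_norm ?subr_lt0// opprB.
- rewrite [leLHS](_ : _ = \int[P]_(t in ~` A) (u t - v t)%:E)%E.
    by rewrite (condE_integralB hu hv)//; exact: le_.
  apply: eq_integral => t; rewrite inE /A/= => /negP; rewrite -leNgt => vu.
  by rewrite ger0_norm ?subr_ge0.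
Qed.

(** Over the event [v < u], which lies in sigma(Z), the positive function [u - v] has the same
    integral as [f - g <= 0]. So [u - v] vanishes almost everywhere on that event, which is
    therefore null. *)
Lemma condE_ae_le f g u v :
  condE_version Z f u -> condE_version Z g v ->
  P.-integrable setT (EFin \o f) -> P.-integrable setT (EFin \o g) ->
  (forall t, f t <= g t) -> {ae P, forall t, u t <= v t}.
Proof.
move=> hu hv iF ig fg.
have sA := condE_lt hv hu; set A := [set t | _] in sA.
have mA := sigma_RV_measurable sA.
have mu := condE_measurable hu; have mv := condE_measurable hv.
have mw : measurable_fun A (fun t => (u t - v t)%:E).
  apply: (@measurable_funS _ _ _ _ setT) => //.
  by apply/measurable_EFinP; exact: measurable_funB.
have : (\int[P]_(t in A) `|(u t - v t)%:E| = 0)%E.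
  apply/eqP; rewrite eq_le integral_ge0 ?andbT//.
  under eq_integral => t.
    rewrite inE /A/= => vu; rewrite gtr0_norm ?subr_gt0//; over.
  rewrite (condE_integralB hu hv)//.
  rewrite -[leRHS](@integral0 _ _ _ P A).
  apply: le_integral => //.
  - apply: (@integrableS _ _ _ _ setT) => //.
    by apply: eq_integrable (integrableB _ iF ig).
  - exact: integrable0.
  - by move=> t _; rewrite lee_fin subr_le0.
move/ae_eq_integral_abs => /(_ mA mw) [N [mN N0 sub]].
exists N; split => // t /= /negP; rewrite -ltNge => vu; apply: sub => /= /(_ vu).
by move=> [] /eqP; rewrite subr_eq0 => /eqP uvE; rewrite uvE ltxx in vu.
Qed.

End condE.

(** * Convergence in L1 and in probability *)

(** An eventual real upper bound also makes the nonnegative terms finite, as convergence to a finite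
    limit demands. *)
Lemma ge0_cvge0P (R : realType) (x : nat -> \bar R) :
  (forall n, 0 <= x n)%E ->
  x n @[n --> \oo] --> 0%E <->
  forall e : R, 0 < e -> \forall n \near \oo, (x n <= e%:E)%E.
Proof.
move=> x0; split=> [/fine_cvgP[xfin /cvgrPdist_le xc] e e0|xe].
  have := xc _ e0; apply: filterS2 xfin => n /= xn.
  by rewrite sub0r normrN ger0_norm ?fine_ge0// -lee_fin fineK.
apply/fine_cvgP; split.
  have := xe _ ltr01; apply: filterS => n xn.
  by rewrite ge0_fin_numE// (le_lt_trans xn)// ltry.
apply/cvgrPdist_le => e e0; have := xe _ e0; apply: filterS => n xn /=.
have xfin : x n \is a fin_num by rewrite ge0_fin_numE// (le_lt_trans xn)// ltry.
by rewrite sub0r normrN ger0_norm ?fine_ge0// -lee_fin fineK.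
Qed.

Section L1.
Context (R : realType) (d : nat -> measure_display)
  (T : forall n, measurableType (d n)) (P : forall n, probability (T n) R).
Implicit Types a b : forall n, T n -> R.

(** Measurability is bundled in so that monotonicity and additivity of the integral apply. The
    integrals are extended reals and may be infinite for finitely many [n]. *)
Definition L1_cvg0 a := (forall n, measurable_fun setT (a n)) /\
  (\int[P n]_t `|a n t|%:E)%E @[n --> \oo] --> 0%E.

Let mnorm a n : measurable_fun setT (a n) ->
  measurable_fun setT (fun t => `|a n t|%:E).
Proof. by move=> ma; apply/measurable_EFinP; exact: measurableT_comp. Qed.

Let norm_ge0 a n : (0 <= \int[P n]_t `|a n t|%:E)%E.
Proof. by apply: integral_ge0 => t _; rewrite lee_fin. Qed.

Lemma L1_cvg0P a : (forall n, measurable_fun setT (a n)) ->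
  L1_cvg0 a <-> forall e : R, 0 < e ->
    \forall n \near \oo, (\int[P n]_t `|a n t|%:E <= e%:E)%E.
Proof.
move=> ma; split=> [[_ /ge0_cvge0P]|ae]; first exact.
by split=> //; apply/ge0_cvge0P.
Qed.

(** The sum of norms is the shape wanted of a dominating sequence in [L1_cvg0_le], after a triangle
    inequality. *)
Lemma L1_cvg0D a b : L1_cvg0 a -> L1_cvg0 b ->
  L1_cvg0 (fun n t => `|a n t| + `|b n t|).
Proof.
move=> [ma ca] [mb cb]; split.
  by move=> n; apply: measurable_funD; exact: measurableT_comp.
rewrite -[0%E]adde0; under eq_fun => n.
  under eq_integral => t _ do rewrite ger0_norm ?addr_ge0// EFinD.
  rewrite ge0_integralD//; [|exact: mnorm..].
  over.
exact: cvgeD.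
Qed.

Lemma L1_cvg0_le a b : (forall n, measurable_fun setT (a n)) -> L1_cvg0 b ->
  (forall n, {ae P n, forall t, `|a n t| <= `|b n t|}) -> L1_cvg0 a.
Proof.
move=> ma [mb cb] ab; split=> //.
apply: (squeeze_cvge _ (cvg_cst 0%E) cb); near=> n.
rewrite norm_ge0/=; apply: ae_ge0_le_integral => //; [exact: mnorm..|].
by apply: filterS (ab n) => t /= abt _; rewrite lee_fin.
Unshelve. all: by end_near. Qed.

Lemma L1_cvg0Z a (k : R) : L1_cvg0 a -> L1_cvg0 (fun n t => k * a n t).
Proof.
move=> [ma ca]; split=> [n|]; first exact: measurable_funM.
rewrite -(mule0 `|k|%:E)%E; under eq_fun => n.
  under eq_integral => t _ do rewrite normrM EFinM.
  rewrite ge0_integralZl_EFin//; [|exact: mnorm].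
  over.
exact: cvgeZl.
Qed.

Lemma L1_cvg0_sum (I : Type) (s : seq I) (a : I -> forall n, T n -> R) :
  (forall i, L1_cvg0 (a i)) -> L1_cvg0 (fun n t => \sum_(i <- s) `|a i n t|).
Proof.
move=> ha; elim: s => [|i s IH].
  split=> [n|].
    rewrite [X in measurable_fun _ X](_ : _ = cst 0)//.
    by apply/funext => t; rewrite big_nil.
  under eq_fun do under eq_integral do rewrite big_nil normr0.
  by under eq_fun do rewrite integral0; exact: cvg_cst.
apply: (L1_cvg0_le _ (L1_cvg0D (ha i) IH)) => n.
  under eq_fun do rewrite big_cons.
  apply: measurable_funD; first by apply: measurableT_comp => //; have [] := ha i.
  by have [] := IH.
apply: aeW => t; rewrite big_cons [leRHS]ger0_norm ?addr_ge0//.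
by apply: le_trans (ler_normD _ _) _; rewrite normr_id.
Qed.

(** Markov's inequality: the probability is at most the L1 norm divided by [e]. *)
Lemma L1_cvg0_cvgP a (c : R) : L1_cvg0 (fun n t => a n t - c) ->
  cvg_in_probability P a c.
Proof.
move=> [ma ca] e e0.
have := cvgeZl (y := e^-1%:E) isT ca; rewrite mule0 => ca'.
apply: (squeeze_cvge _ (cvg_cst 0%E) ca'); near=> n; rewrite measure_ge0/=.
rewrite lee_pdivlMl//.
apply: (@le_trans _ _ _ _ _ _ (le_integral_abse
  (g := fun t => (a n t - c)%:E) (P n) measurableT _ e0)).
  (* Markov's inequality concerns the event with [e <=], which contains the strict event of the
     definition. *)
  rewrite lee_pmul2l//; apply: le_measure; rewrite ?inE.
  - rewrite [X in measurable X](_ : _ =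
      setT `&` (fun t => `|a n t - c|) @^-1` `]e, +oo[).
      apply: (measurableT_comp (@normr_measurable _ _) (ma n)) => //.
    by rewrite setTI; apply/seteqP; split=> t /=; rewrite in_itv/= andbT.
  - apply: measurableI => //.
    rewrite [X in measurable X](_ : _ =
      setT `&` (fun t => `|a n t - c|) @^-1` `[e, +oo[).
      apply: (measurableT_comp (@normr_measurable _ _) (ma n)) => //.
    by rewrite setTI; apply/seteqP; split=> t /=; rewrite in_itv/= andbT lee_fin.
  - by move=> t /= et; split=> //=; rewrite lee_fin ltW.
exact/measurable_EFinP.
Unshelve. all: by end_near. Qed.

(** Bounded convergence: [|a - c|] is at most [e / 2] off the event [A] where it exceeds [e / 2],
    and at most a constant [K] on [A], whose probability is eventually at most [e / 2 / K]. *)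
Lemma bounded_cvgP_L1 a (c M : R) : (forall n, measurable_fun setT (a n)) ->
  (forall n, {ae P n, forall t, `|a n t| <= M}) ->
  cvg_in_probability P a c -> L1_cvg0 (fun n t => a n t - c).
Proof.
move=> ma aM ac.
have mac n : measurable_fun setT (fun t => a n t - c) by exact: measurable_funB.
apply/L1_cvg0P => // e e0.
have e20 : 0 < e / 2 by lra.
(* The summand 1 only makes [K] positive, so that dividing by it is legitimate. *)
pose K := `|M| + `|c| + 1; have K0 : 0 < K by rewrite ltr_wpDl ?addr_ge0.
have KP : 0 < e / 2 / K by rewrite divr_gt0.
have /ge0_cvge0P := ac _ e20.
move=> /(_ (fun n => measure_ge0 _ _)) /(_ _ KP); apply: filterS => n Pn.
set A := [set t | _] in Pn.
have mA : measurable A.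
  rewrite [X in measurable X](_ : _ =
      setT `&` (fun t => `|a n t - c|) @^-1` `]e / 2, +oo[).
    apply: (measurableT_comp (@normr_measurable _ _) (mac n)) => //.
  by rewrite setTI; apply/seteqP; split=> t /=; rewrite in_itv/= andbT.
apply: (@le_trans _ _ (\int[P n]_t ((e / 2)%:E + K%:E * (\1_A t)%:E))%E).
  apply: ae_ge0_le_integral => //.
  - exact: (mnorm (a := fun n t => a n t - c)).
  - by move=> t _; rewrite -EFinM -EFinD lee_fin addr_ge0 ?mulr_ge0// ltW.
  - apply: emeasurable_funD => //; apply: measurable_funeM.
    exact/measurable_EFinP.
  apply: filterS (aM n) => t aMt _; rewrite -EFinM -EFinD lee_fin indicE.
  case: (boolP (t \in A)) => /= tA; last first.
    by rewrite mulr0 addr0 leNgt; apply: contra tA => ?; rewrite inE.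
  rewrite mulr1 (le_trans (ler_normB _ _))// /K.
  have := ler_norm M; lra.
rewrite ge0_integralD//; last 3 first.
- by move=> t _; rewrite lee_fin ltW.
- by move=> t _; rewrite -EFinM lee_fin mulr_ge0// ltW.
- by apply: measurable_funeM; exact/measurable_EFinP.
rewrite ge0_integralZl_EFin//; last 2 first.
- exact/measurable_EFinP.
- exact: ltW.
rewrite integral_indic// setIT (integral_cst (P n) measurableT (e / 2)%:E).
rewrite [X in (_ * X + _)%E](_ : _ = 1%E) ?mule1; last exact: probability_setT.
rewrite [leRHS](_ : _ = (e / 2)%:E + (e / 2)%:E)%E; last by rewrite -EFinD -splitr.
by rewrite leeD2l// -lee_pdivlMl// -EFinM mulrC.
Qed.

(** The integral of [a] is that of [b] plus that of [a - b], and the latter is squeezed between plus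
    and minus the L1 norm. *)
Lemma L1_cvg0_integral a b (c : R) : L1_cvg0 (fun n t => a n t - b n t) ->
  (forall n, measurable_fun setT (a n)) ->
  (forall n, (P n).-integrable setT (EFin \o b n)) ->
  (\int[P n]_t (b n t)%:E)%E @[n --> \oo] --> c%:E ->
  (\int[P n]_t (a n t)%:E)%E @[n --> \oo] --> c%:E.
Proof.
move=> [mab cab] ma ib cb.
pose D n := (\int[P n]_t (a n t - b n t)%:E)%E.
have cD : D n @[n --> \oo] --> 0%E.
  have cNab : (- \int[P n]_t `|a n t - b n t|%:E)%E @[n --> \oo] --> 0%E.
    by rewrite -oppe0; exact: cvgeN.
  apply: (squeeze_cvge _ cNab cab); near=> n.
  have Dle : (`|D n| <= \int[P n]_t `|a n t - b n t|%:E)%E.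
    by apply: le_abse_integral => //; exact/measurable_EFinP.
  rewrite (le_trans (lee_abs _) Dle) andbT leeNl.
  by rewrite (le_trans (lee_abs _))// abseN.
rewrite -[c%:E]add0e.
have cDb : (D n + \int[P n]_t (b n t)%:E)%E @[n --> \oo] --> (0 + c%:E)%E.
  exact: cvgeD.
apply: cvg_trans cDb; apply: near_eq_cvg.
(* Adding the integrals requires [a n - b n] to be integrable, which the convergence provides for
   large [n]. *)
have abfin : \forall n \near \oo, (\int[P n]_t `|a n t - b n t|%:E < +oo)%E.
  have /fine_cvgP[+ _] := cab; apply: filterS => n.
  by rewrite ge0_fin_numE//; exact: (@norm_ge0 (fun n t => a n t - b n t)).
apply: filterS abfin => n abfin /=.
have iab : (P n).-integrable setT (EFin \o (fun t => a n t - b n t)).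
  by apply/integrableP; split=> //; exact/measurable_EFinP.
rewrite /D -integralD_EFin//.
by apply: eq_integral => t _ /=; rewrite -EFinD subrK.
Unshelve. all: by end_near. Qed.

End L1.

(** * Integer valued random variables and interpolation *)

Lemma Rintegral_probability_cst (R : realType) (d : measure_display)
    (T : measurableType d) (P : probability T R) (c : R) : \int[P]_(_ in setT) c = c.
Proof.
rewrite Rintegral_cst// [X in fine X](_ : _ = 1%E) ?mulr1//.
exact: probability_setT.
Qed.

Section integer_valued.
Context (R : realType) (d : measure_display) (T : measurableType d)
  (P : probability T R) (X Y : {RV P >-> R}).
Hypotheses (Xint : integer_valued X) (Yint : integer_valued Y).

(** Versions are chosen separately at each point, so no joint measurability of [G] is at hand.
    Instead, the space is cut into the countably many events [X = k, Y = l], on each of which the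
    function is [G k l]. *)
Lemma measurable_int_comp (G : R -> R -> T -> R) :
  (forall k l, k \is a Num.int -> l \is a Num.int -> measurable_fun setT (G k l)) ->
  measurable_fun setT (fun t => G (X t) (Y t) t).
Proof.
move=> mG _ B mB; rewrite setTI.
rewrite (_ : _ @^-1` B = \bigcup_n
    (if unpickle n is Some (k, l) then
      X @^-1` [set k%:~R] `&` Y @^-1` [set l%:~R] `&`
      G (k : int)%:~R (l : int)%:~R @^-1` B else set0)).
  apply: bigcupT_measurable => n; case: unpickle => [[k l]|//].
  apply: measurableI; last first.
    by rewrite -[_ @^-1` _]setTI; apply: mG; rewrite ?intr_int.
  by apply: measurableI; exact: measurable_funPTI.
apply/seteqP; split=> t /=.
  move=> GB; have /intrP[k kE] := Xint t; have /intrP[l lE] := Yint t.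
  by exists (pickle (k, l)); [exact: I|rewrite pickleK -kE -lE].
by move=> [n _]; case: unpickle => [[k l] [[/= -> ->]]|].
Qed.

(** The exceptional null set may depend on [(k, l)], but there are only countably many integer pairs
    and the union of their null sets is null. *)
Lemma ae_int_comp (Q : R -> R -> T -> Prop) :
  (forall k l, k \is a Num.int -> l \is a Num.int -> {ae P, forall t, Q k l t}) ->
  {ae P, forall t, Q (X t) (Y t) t}.
Proof.
move=> aeQ.
have : {ae P, forall t, forall n : nat,
    if unpickle n is Some (k, l) then Q (k : int)%:~R (l : int)%:~R t else True}.
  apply: ae_foralln => n; case: unpickle => [[k l]|]; last exact: aeW.
  by apply: aeQ; rewrite intr_int.
apply: filterS => t Qt.
have /intrP[k kE] := Xint t; have /intrP[l lE] := Yint t.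
by have := Qt (pickle (k, l)); rewrite pickleK -kE -lE.
Qed.

Lemma measurable_int_pair (h : R -> R -> R) :
  measurable_fun setT (fun t => h (X t) (Y t)).
Proof. by apply: (@measurable_int_comp (fun k l => cst (h k l))). Qed.

End integer_valued.

Lemma bounded_integrable (R : realType) (d : measure_display)
    (T : measurableType d) (P : probability T R) (f : T -> R) (M : R) :
  measurable_fun setT f -> {ae P, forall t, `|f t| <= M} ->
  P.-integrable setT (EFin \o f).
Proof.
move=> mf fM; apply/integrableP; split; first exact/measurable_EFinP.
apply: (@le_lt_trans _ _ (\int[P]_t (cst `|M|%:E t))%E).
  apply: ae_ge0_le_integral => //.
  - by apply/measurable_EFinP; exact: measurableT_comp.
  - by move=> t _; rewrite lee_fin.
  - by apply: filterS fM => t fMt _; rewrite lee_fin (le_trans fMt)// ler_norm.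
rewrite integral_cst// [X in (_ * X)%E](_ : _ = 1%E) ?mule1 ?ltry//.
exact: probability_setT.
Qed.

(** * Lipschitz kernels that interpolate indicators *)

Section step.
Context {R : realType}.
Implicit Types a b x y : R.

(** Equal to 1 up to [a], to 0 from [a + 1] on, and linear between. Only [a - x] enters, so it is
    Lipschitz in the threshold [a] as well as in [x]. *)
Definition step a x : R := Num.min 1 (Num.max 0 (a + 1 - x)).

Lemma step_itv a x : 0 <= step a x <= 1.
Proof. by rewrite /step le_min ler01 le_max ge_min !lexx. Qed.

Lemma step_lip a b x y : `|step a x - step b y| <= `|a - b| + `|x - y|.
Proof.
rewrite /step /Num.min /Num.max; rewrite ler_norml.
have := ler_norm (a - b); have := ler_norm (b - a); rewrite distrC.
have := ler_norm (x - y); have := ler_norm (y - x); rewrite (distrC y x).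
by repeat (case: ifPn => /=; rewrite -?leNgt); lra.
Qed.

(** An integer exceeding the integer [a] is at least [a + 1], where [step a] has already reached
    0. *)
Lemma step_int a x : a \is a Num.int -> x \is a Num.int ->
  step a x = (x <= a)%R%:R.
Proof.
move=> /intrP[m ->] /intrP[k ->]; rewrite ler_int /step.
case: (lerP k m) => [km|mk].
  have : (k%:~R : R) <= m%:~R by rewrite ler_int.
  by move=> ?; rewrite max_r ?min_l//; lra.
have : (m%:~R + 1 : R) <= k%:~R.
  by rewrite -[X in _ + X]/(1%:~R) -intrD ler_int -[1]/(1%Z) lezD1.
by move=> ?; rewrite max_l ?min_r//; lra.
Qed.

End step.

Lemma lipschitz_continuous (R : realType) (h : R * R -> R) :
  (forall p q, `|h p - h q| <= `|p.1 - q.1| + `|p.2 - q.2|) -> continuous h.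
Proof.
move=> hlip p; apply/cvgrPdist_le => e e0.
have e20 : 0 < e / 2 by lra.
have c1 : q.1 @[q --> p] --> p.1 by exact: cvg_fst.
have c2 : q.2 @[q --> p] --> p.2 by exact: cvg_snd.
near=> q; apply: le_trans (hlip _ _) _.
rewrite [leRHS](splitr e); apply: lerD; near: q.
  by move/cvgrPdist_le : c1; exact.
by move/cvgrPdist_le : c2; exact.
Unshelve. all: by end_near. Qed.

(** A test function of [p] indexed by two thresholds. The Lipschitz bound in [p] makes it an
    admissible test function; the bound in [(a, b)] makes its mean continuous in the thresholds. Two
    thresholds let one notion serve marginal and joint cdfs alike. *)
Definition lip_kernel (R : realType) (phi : R -> R -> R * R -> R) :=
  (forall a b p, 0 <= phi a b p <= 1) /\
  (forall a b a' b' p p', `|phi a b p - phi a' b' p'| <=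
     `|a - a'| + `|b - b'| + `|p.1 - p'.1| + `|p.2 - p'.2|).

Section kernels.
Context {R : realType}.
Implicit Types phi : R -> R -> R * R -> R.

Lemma lip_kernel_continuous phi a b : lip_kernel phi -> continuous (phi a b).
Proof.
move=> [_ lip]; apply: lipschitz_continuous => p q.
by have := lip a b a b p q; rewrite !subrr !normr0 !add0r.
Qed.

Lemma lip_kernel_norm phi a b p : lip_kernel phi -> `|phi a b p| <= 1.
Proof. by move=> [/(_ a b p)/andP[p0 p1] _]; rewrite ger0_norm. Qed.

(** Shifts by 0 or 1 produce the terms at [k - 1] and [l - 1] in [calF] and [calH]. *)
Lemma lip_kernel_shift phi (u v : R) : lip_kernel phi ->
  lip_kernel (fun a b => phi (a - u) (b - v)).
Proof.
move=> [itv lip]; split=> // a b a' b' p p'; apply: le_trans (lip _ _ _ _ _ _) _.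
by rewrite (_ : a - u - (a' - u) = a - a') 1?(_ : b - v - (b' - v) = b - b')//; lra.
Qed.

Lemma lip_kernel_step1 : lip_kernel (fun (a _ : R) (p : R * R) => step a p.1).
Proof.
split=> [*|a b a' b' p p']; first exact: step_itv.
apply: le_trans (step_lip _ _ _ _) _.
by have := normr_ge0 (b - b'); have := normr_ge0 (p.2 - p'.2); lra.
Qed.

Lemma lip_kernel_step2 : lip_kernel (fun (_ b : R) (p : R * R) => step b p.2).
Proof.
split=> [*|a b a' b' p p']; first exact: step_itv.
apply: le_trans (step_lip _ _ _ _) _.
by have := normr_ge0 (a - a'); have := normr_ge0 (p.1 - p'.1); lra.
Qed.

Lemma lip_kernel_stepM :
  lip_kernel (fun a b (p : R * R) => step a p.1 * step b p.2).
Proof.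
split=> [a b p|a b a' b' p p'].
  have /andP[? ?] := step_itv a p.1; have /andP[? ?] := step_itv b p.2.
  by rewrite mulr_ge0//= mulr_ile1.
have := step_lip a a' p.1 p'.1; have := step_lip b b' p.2 p'.2.
have /andP[] := step_itv a p.1; have /andP[] := step_itv b' p'.2.
set x := step a _; set y := step b _; set x' := step a' _; set y' := step b' _.
move=> y0 y1 x0 x1 yy xx.
(* The usual splitting of a difference of products; both outer factors lie between 0 and 1. *)
rewrite (_ : _ - _ = x * (y - y') + y' * (x - x')); last by lra.
apply: le_trans (ler_normD _ _) _; rewrite !normrM (ger0_norm x0) (ger0_norm y0).
have := ler_piMl (normr_ge0 (y - y')) x1.
have := ler_piMl (normr_ge0 (x - x')) y1.
by lra.
Qed.

End kernels.

Section interpolation.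
Context (R : realType) (d : measure_display) (T : measurableType d)
  (P : probability T R) (X Y : {RV P >-> R}).
Hypotheses (Xint : integer_valued X) (Yint : integer_valued Y).

(** For the step kernels this is the continuous interpolation of the cdf of [X], of [Y] or of the
    pair, as a function of the thresholds. *)
Definition kernel_mean (phi : R -> R -> R * R -> R) (a b : R) : R :=
  \int[P]_t phi a b (X t, Y t).

Lemma integrable_int_pair (h : R * R -> R) (M : R) : (forall p, `|h p| <= M) ->
  P.-integrable setT (fun t => (h (X t, Y t))%:E).
Proof.
move=> hM; apply: (@bounded_integrable _ _ _ P _ M); last exact: aeW.
exact: (measurable_int_pair Xint Yint (fun x y => h (x, y))).
Qed.

Context (phi : R -> R -> R * R -> R) (phiP : lip_kernel phi).

Let iphi a b : P.-integrable setT (fun t => (phi a b (X t, Y t))%:E).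
Proof.
by apply: (integrable_int_pair (M := 1)) => p; exact: lip_kernel_norm.
Qed.

Lemma kernel_mean_itv a b : 0 <= kernel_mean phi a b <= 1.
Proof.
have [itv _] := phiP; apply/andP; split.
  by apply: Rintegral_ge0 => t _; have /andP[] := itv a b (X t, Y t).
rewrite -[leRHS](Rintegral_probability_cst P).
apply: le_Rintegral => //.
- exact: iphi.
- exact: finite_measure_integrable_cst.
by move=> t _; have /andP[] := itv a b (X t, Y t).
Qed.

Lemma kernel_mean_norm a b : `|kernel_mean phi a b| <= 1.
Proof. by have /andP[? ?] := kernel_mean_itv a b; rewrite ger0_norm. Qed.

Lemma kernel_mean_lip a b a' b' :
  `|kernel_mean phi a b - kernel_mean phi a' b'| <= `|a - a'| + `|b - b'|.
Proof.
have [_ lip] := phiP.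
rewrite /kernel_mean -RintegralB//; [|exact: iphi..].
apply: le_trans (le_normr_Rintegral _ _) _ => //.
  apply: eq_integrable (integrableB _ (iphi a b) (iphi a' b')) => //.
rewrite -[leRHS](Rintegral_probability_cst P).
apply: le_Rintegral => //.
- apply: integrable_norm.
  by apply: eq_integrable (integrableB _ (iphi a b) (iphi a' b')).
- exact: finite_measure_integrable_cst.
- move=> t _; apply: le_trans (lip _ _ _ _ _ _) _ => /=.
  by rewrite !subrr normr0 !addr0.
Qed.

Lemma kernel_mean_continuous :
  continuous (fun p : R * R => kernel_mean phi p.1 p.2).
Proof. by apply: lipschitz_continuous => p q; exact: kernel_mean_lip. Qed.

End interpolation.

(** * Limits under conditional convergence in distribution *)

Section conditional_limit.
Context (R : realType) (d d' : nat -> measure_display)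
  (T : forall n, measurableType (d n)) (E : forall n, measurableType (d' n))
  (P : forall n, probability (T n) R)
  (X Y : forall n, {RV P n >-> R}) (Z : forall n, {RV P n >-> E n})
  (d0 : measure_display) (T0 : measurableType d0) (P0 : probability T0 R)
  (X0 Y0 : {RV P0 >-> R}).
Hypotheses (Xint : forall n, integer_valued (X n))
  (Yint : forall n, integer_valued (Y n))
  (X0int : integer_valued X0) (Y0int : integer_valued Y0)
  (cvgXY : cvg_in_distribution_given X Y Z X0 Y0).
Arguments Xint : clear implicits.
Arguments Yint : clear implicits.

Section test.
Context (h : R * R -> R) (M : R).
Hypotheses (hc : continuous h) (hM : forall p, `|h p| <= M).

Let h0 := \int[P0]_t h (X0 t, Y0 t).

Let ih n : (P n).-integrable setT (fun t => (h (X n t, Y n t))%:E).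
Proof. exact: integrable_int_pair hM. Qed.

(** The hypothesis yields a version converging in probability. By comparison with the constants
    [- M] and [M] it is bounded almost everywhere, so the convergence holds in L1. *)
Lemma exists_condE_cvg : exists g : forall n, T n -> R,
  (forall n, condE_version (Z n) (fun t => h (X n t, Y n t)) (g n)) /\
  L1_cvg0 P (fun n t => g n t - h0).
Proof.
have [g [gP gc]] := cvgXY hc (ex_intro _ M hM).
exists g; split=> //; apply: (@bounded_cvgP_L1 _ _ _ _ _ _ M).
- by move=> n; exact: condE_measurable (gP n).
- move=> n.
  have lo : {ae P n, forall t, cst (- M) t <= g n t}.
    apply: condE_ae_le (condE_cst _ _) (gP n) _ _ _ => //.
      exact: finite_measure_integrable_cst.
    by move=> t /=; have := hM (X n t, Y n t); rewrite ler_norml => /andP[].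
  have up : {ae P n, forall t, g n t <= cst M t}.
    apply: condE_ae_le (gP n) (condE_cst _ _) _ _ _ => //.
      exact: finite_measure_integrable_cst.
    by move=> t /=; have := hM (X n t, Y n t); rewrite ler_norml => /andP[].
  by apply: filterS2 lo up => t lo up; rewrite ler_norml lo.
- by move: gc; rewrite unlock.
Qed.

(** By contraction, the L1 distance of [U] to the convergent version for [h] is at most that of [W]
    to [h(X_n, Y_n)]. Here [U] is an arbitrary version, so the limit does not depend on the
    choice. *)
Lemma condE_cvg_L1 (W U : forall n, T n -> R) :
  (forall n, (P n).-integrable setT (EFin \o W n)) ->
  L1_cvg0 P (fun n t => W n t - h (X n t, Y n t)) ->
  (forall n, condE_version (Z n) (W n) (U n)) ->
  L1_cvg0 P (fun n t => U n t - h0).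
Proof.
move=> iW Wh UP; have [g [gP gc]] := exists_condE_cvg.
have mU n := condE_measurable (UP n); have mg n := condE_measurable (gP n).
have Ug : L1_cvg0 P (fun n t => U n t - g n t).
  split=> [n|]; first exact: measurable_funB.
  have [_ Wh0] := Wh; apply: (squeeze_cvge _ (cvg_cst 0%E) Wh0); near=> n.
  rewrite integral_ge0/=; last by move=> t _; rewrite lee_fin.
  exact: condE_contraction (UP n) (gP n) _ _.
apply: (L1_cvg0_le _ (L1_cvg0D Ug gc)) => n; first exact: measurable_funB.
apply: aeW => t; rewrite [leRHS]ger0_norm ?addr_ge0//.
by rewrite (_ : U n t - h0 = (U n t - g n t) + (g n t - h0)) ?ler_normD//; lra.
Unshelve. all: by end_near. Qed.

(** A version has the same integral over the whole space as the function itself, so L1 convergence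
    of the versions gives unconditional convergence in distribution. *)
Lemma integral_int_pair_cvg :
  (\int[P n]_t (h (X n t, Y n t))%:E)%E @[n --> \oo] --> h0%:E.
Proof.
have [g [gP gc]] := exists_condE_cvg.
rewrite (_ : (fun n => _) = fun n => (\int[P n]_t (g n t)%:E)%E).
  apply: (L1_cvg0_integral gc).
  - by move=> n; exact: condE_measurable (gP n).
  - by move=> n; exact: finite_measure_integrable_cst.
  - under eq_fun => n.
      rewrite (integral_cst (P n) measurableT h0%:E).
      rewrite [X in (_ * X)%E](_ : _ = 1%E) ?mule1; last exact: probability_setT.
      over.
    exact: cvg_cst.
apply/funext => n; have [_ _ ->//] := gP n.
by exists setT => //; rewrite setTI.
Qed.

Lemma integral_cvg_L1 (W : forall n, T n -> R) :
  (forall n, (P n).-integrable setT (EFin \o W n)) ->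
  L1_cvg0 P (fun n t => W n t - h (X n t, Y n t)) ->
  (\int[P n]_t (W n t)%:E)%E @[n --> \oo] --> h0%:E.
Proof.
move=> iW Wh; apply: (L1_cvg0_integral Wh) => [n|n|].
- by apply/measurable_EFinP; exact: measurable_int (iW n).
- exact: ih.
- exact: integral_int_pair_cvg.
Qed.

End test.

(** At an integer point this counts the coordinates of absolute value above [K]. Being bounded and
    continuous, it transfers tightness from the limit to [(X_n, Y_n)]. *)
Let tail (K : nat) (p : R * R) : R := 2 - step K%:R `|p.1| - step K%:R `|p.2|.

Let tail_itv K p : 0 <= tail K p <= 2.
Proof.
rewrite /tail.
have /andP[? ?] := step_itv K%:R `|p.1|; have /andP[? ?] := step_itv K%:R `|p.2|.
by apply/andP; split; lra.
Qed.

Let tail_norm K p : `|tail K p| <= 2.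
Proof. by have /andP[? ?] := tail_itv K p; rewrite ger0_norm. Qed.

Let tail_continuous K : continuous (tail K).
Proof.
apply: lipschitz_continuous => p q; rewrite /tail.
have := step_lip K%:R K%:R `|p.1| `|q.1|.
have := step_lip K%:R K%:R `|p.2| `|q.2|.
have := ler_dist_dist p.1 q.1; have := ler_dist_dist p.2 q.2.
rewrite !subrr normr0 !add0r => l2 l1 s2 s1.
rewrite distrC (_ : _ - _ = (step K%:R `|p.1| - step K%:R `|q.1|) +
  (step K%:R `|p.2| - step K%:R `|q.2|)); last by lra.
apply: le_trans (ler_normD _ _) _.
by apply: lerD; [exact: le_trans s1 l1|exact: le_trans s2 l2].
Qed.

Let norm_int (x : R) : x \is a Num.int -> `|x| \is a Num.int.
Proof. by move=> /intrP[m ->]; rewrite -intr_norm intr_int. Qed.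

Let tail_int K x y : x \is a Num.int -> y \is a Num.int ->
  ~~ ((`|x| <= K%:R) && (`|y| <= K%:R)) -> 1 <= tail K (x, y).
Proof.
move=> xi yi; rewrite /tail/= !step_int ?natr_int ?norm_int//.
by case: (_ <= _); case: (_ <= _) => //=; lra.
Qed.

(** Dominated convergence with the bound 2: at each [t] the tail function vanishes once [K] exceeds
    both [|X0 t|] and [|Y0 t|]. *)
Let tail_mean_cvg :
  (\int[P0]_t (tail K (X0 t, Y0 t))%:E)%E @[K --> \oo] --> 0%E.
Proof.
rewrite -(@integral0 _ _ _ P0 setT).
have mt K : measurable_fun setT (fun t => (tail K (X0 t, Y0 t))%:E).
  apply/measurable_EFinP.
  exact: (measurable_int_pair X0int Y0int (fun x y => tail K (x, y))).
have tcvg : {ae P0, forall t, setT t ->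
    (tail K (X0 t, Y0 t))%:E @[K --> \oo] --> cst 0%E t}.
  apply: aeW => t _; apply: cvg_near_cst; near=> K; congr (_%:E).
  rewrite /tail /= !step_int ?natr_int ?norm_int//.
  have -> : `|X0 t| <= K%:R by near: K; exact: nbhs_infty_ger.
  have -> : `|Y0 t| <= K%:R by near: K; exact: nbhs_infty_ger.
  by rewrite /=; lra.
have i2 : P0.-integrable setT (cst 2%:E) by exact: finite_measure_integrable_cst.
have t2 : {ae P0, forall t, forall K : nat, setT t ->
    (`|(tail K (X0 t, Y0 t))%:E| <= cst 2%:E t)%E}.
  by apply: aeW => t K _; rewrite lee_fin tail_norm.
by have [] := dominated_convergence measurableT mt (measurable_cst _) tcvg i2 t2.
Unshelve. all: by end_near. Qed.

(** * Versions evaluated at the random point *)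

Section kernel.
Context (phi : R -> R -> R * R -> R) (phiP : lip_kernel phi).
Context (G : forall n, R -> R -> T n -> R).
Arguments G : clear implicits.
Hypothesis GP : forall n k l, k \is a Num.int -> l \is a Num.int ->
  condE_version (Z n) (fun t => phi k l (X n t, Y n t)) (G n k l).

Let iphi n a b : (P n).-integrable setT (fun t => (phi a b (X n t, Y n t))%:E).
Proof.
apply: (integrable_int_pair (Xint n) (Yint n) (h := phi a b) (M := 1)) => p.
exact: lip_kernel_norm.
Qed.

(** For fixed integers this is comparison with the constant versions 0 and 1; random arguments cost
    only countably many null sets. *)
Lemma kernel_ae_itv n : {ae P n, forall t, 0 <= G n (X n t) (Y n t) t <= 1}.
Proof.
apply: (ae_int_comp (Xint n) (Yint n) (Q := fun k l t => 0 <= G n k l t <= 1)).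
move=> k l ki li.
have lo : {ae P n, forall t, cst 0 t <= G n k l t}.
  apply: condE_ae_le (condE_cst _ _) (@GP n k l ki li) _ _ _.
  - exact: finite_measure_integrable_cst.
  - exact: iphi.
  - by move=> t /=; have [/(_ k l (X n t, Y n t))/andP[]] := phiP.
have up : {ae P n, forall t, G n k l t <= cst 1 t}.
  apply: condE_ae_le (@GP n k l ki li) (condE_cst _ _) _ _ _.
  - exact: iphi.
  - exact: finite_measure_integrable_cst.
  - by move=> t /=; have [/(_ k l (X n t, Y n t))/andP[]] := phiP.
by apply: filterS2 lo up => t /= -> ->.
Qed.

Lemma kernel_measurable n : measurable_fun setT (fun t => G n (X n t) (Y n t) t).
Proof.
apply: (measurable_int_comp (Xint n) (Yint n)) => k l ki li.
exact: condE_measurable (@GP n k l ki li).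
Qed.

Let Phi := kernel_mean X0 Y0 phi.

Let mPhi n : measurable_fun setT (fun t => Phi (X n t) (Y n t)).
Proof. exact: (measurable_int_pair (Xint n) (Yint n)). Qed.

(* Off the square [|X_n|, |Y_n| <= K] the difference is at most 1 and is
   dominated by the tail function; on it, by finitely many terms, each of
   which tends to 0 in L1. *)
Lemma kernel_L1 :
  L1_cvg0 P (fun n t => G n (X n t) (Y n t) t - Phi (X n t) (Y n t)).
Proof.
have mD n : measurable_fun setT (fun t => G n (X n t) (Y n t) t - Phi (X n t) (Y n t)).
  by apply: measurable_funB => //; exact: kernel_measurable.
apply/L1_cvg0P => // e e0.
have e20 : 0 < e / 2 by lra. have e40 : 0 < e / 4 by lra.
have t0 K : (0 <= \int[P0]_t (tail K (X0 t, Y0 t))%:E)%E.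
  by apply: integral_ge0 => t _; rewrite lee_fin;
      have /andP[] := tail_itv K (X0 t, Y0 t).
(* The limit tail takes one quarter of [e], and the convergence of the tail means at this [K]
   another; the remaining half goes to the square. *)
have /(ge0_cvge0P t0) /(_ _ e40) [K _ /(_ K (leqnn K)) tK] := tail_mean_cvg.
have tailn : \forall n \near \oo,
    (\int[P n]_t (tail K (X n t, Y n t))%:E <= (e / 2)%:E)%E.
  have := integral_int_pair_cvg (tail_continuous (K := K)) (tail_norm K).
  move=> /fine_cvgP[tfin /cvgrPdist_le /(_ _ e40)]; apply: filterS2 tfin => n tfin.
  rewrite /= -[X in X <= _]normrN opprB => /ler_normlW.
  rewrite lerBlDr => H; rewrite -(fineK tfin) lee_fin (le_trans H)//.
  have : \int[P0]_t tail K (X0 t, Y0 t) <= e / 4.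
    rewrite -lee_fin fineK//; apply: integrable_fin_num => //.
    by apply: integrable_int_pair => // p; exact: tail_norm.
  by lra.
(* The integers from [-K] to [K], which are [2K + 1] in number. *)
pose s : seq int := [seq i%:Z - K%:Z | i <- iota 0 K.*2.+1].
have sP x : x \is a Num.int -> `|x| <= K%:R -> exists2 m, m \in s & x = m%:~R :> R.
  move=> /intrP[m ->]; rewrite -intr_norm -[K%:R]/(K%:~R) ler_int => mK.
  exists m => //; apply/mapP; exists (absz (m + K%:Z)).
    by rewrite mem_iota; move: mK; lia.
  by move: mK; lia.
pose A (m : int * int) n t := G n m.1%:~R m.2%:~R t - Phi m.1%:~R m.2%:~R.
(* Here [W] is the test function itself, so its L1 distance to the test function is 0. *)
have A0 m : L1_cvg0 P (A m).
  apply: (@condE_cvg_L1 (phi m.1%:~R m.2%:~R) 1 _ _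
    (fun n t => phi m.1%:~R m.2%:~R (X n t, Y n t))).
  - exact: lip_kernel_continuous.
  - by move=> p; exact: lip_kernel_norm.
  - by move=> n; exact: iphi.
  - split=> [n|].
      under eq_fun do rewrite subrr.
      exact: measurable_cst.
    under eq_fun do under eq_integral do rewrite subrr normr0.
    under eq_fun do rewrite integral0.
    exact: cvg_cst.
  - by move=> n; apply: GP; exact: intr_int.
have := L1_cvg0_sum [seq (k, l) | k <- s, l <- s] A0.
set S := fun n t => _; move=> S0.
have [mS _] := S0; have Sn := iffLR (L1_cvg0P P mS) S0 _ e20.
apply: filterS2 tailn Sn => n tailn Sn.
rewrite (splitr e) EFinD; apply: le_trans (leeD Sn tailn).
have mt : measurable_fun setT (fun t => (tail K (X n t, Y n t))%:E).
  apply/measurable_EFinP.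
  exact: (measurable_int_pair (Xint n) (Yint n) (fun x y => tail K (x, y))).
rewrite -ge0_integralD//; last 2 first.
- by apply/measurable_EFinP; exact: measurableT_comp.
- by move=> t _; rewrite lee_fin; have /andP[] := tail_itv K (X n t, Y n t).
apply: ae_ge0_le_integral => //.
- by apply/measurable_EFinP; exact: measurableT_comp.
- move=> t _; rewrite -EFinD lee_fin addr_ge0//.
  by have /andP[] := tail_itv K (X n t, Y n t).
- apply: emeasurable_funD => //.
  by apply/measurable_EFinP; exact: measurableT_comp.
apply: filterS (kernel_ae_itv n) => t Gt _; rewrite -EFinD lee_fin.
have S_ge0 : 0 <= S n t by apply: sumr_ge0.
rewrite (ger0_norm S_ge0).
case: (boolP ((`|X n t| <= K%:R) && (`|Y n t| <= K%:R))) => [/andP[Xs Ys]|].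
  have /andP[tail0 _] := tail_itv K (X n t, Y n t).
  have [k ks kE] := sP _ (Xint n t) Xs; have [l ls lE] := sP _ (Yint n t) Ys.
  have kls : (k, l) \in [seq (k, l) | k <- s, l <- s] by exact: allpairs_f.
  rewrite -[leLHS]addr0 lerD// /S (big_rem _ kls)/= /A/= -kE -lE lerDl.
  exact: sumr_ge0.
move/(tail_int (Xint n t) (Yint n t)) => tail1.
rewrite -[leLHS]add0r lerD// (le_trans _ tail1)//.
have /andP[? ?] := kernel_mean_itv X0int Y0int phiP (X n t) (Y n t).
by rewrite ler_norml /Phi; lra.
Qed.

End kernel.

Section two_kernels.
Context (phi psi : R -> R -> R * R -> R).
Hypotheses (phiP : lip_kernel phi) (psiP : lip_kernel psi).

(** With a kernel and its shift this is the limit of [calF]; two such sums make up the limit of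
    [calH]. *)
Definition mean2 (p : R * R) : R :=
  kernel_mean X0 Y0 phi p.1 p.2 + kernel_mean X0 Y0 psi p.1 p.2.

Lemma mean2_continuous : continuous mean2.
Proof. by move=> p; apply: cvgD; exact: kernel_mean_continuous. Qed.

Lemma mean2_norm p : `|mean2 p| <= 2.
Proof.
rewrite (le_trans (ler_normD _ _))// (_ : 2 = 1 + 1)//.
by apply: lerD; exact: kernel_mean_norm.
Qed.

Context (G K : forall n, R -> R -> T n -> R).
Arguments G : clear implicits.
Arguments K : clear implicits.
Hypotheses
  (GP : forall n k l, k \is a Num.int -> l \is a Num.int ->
    condE_version (Z n) (fun t => phi k l (X n t, Y n t)) (G n k l))
  (KP : forall n k l, k \is a Num.int -> l \is a Num.int ->
    condE_version (Z n) (fun t => psi k l (X n t, Y n t)) (K n k l)).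

Let W n t := G n (X n t) (Y n t) t + K n (X n t) (Y n t) t.
Arguments W : clear implicits.

(** [kernel_L1] is applied to each summand. The almost sure bound 2 is recorded for integrability
    and for products of two such sums. *)
Lemma two_kernels_L1 : [/\ forall n, measurable_fun setT (W n),
  forall n, {ae P n, forall t, `|W n t| <= 2} &
  L1_cvg0 P (fun n t => W n t - mean2 (X n t, Y n t))].
Proof.
have mW n : measurable_fun setT (W n).
  by apply: measurable_funD;
    [exact: (kernel_measurable GP)|exact: (kernel_measurable KP)].
split=> // [n|].
  have := kernel_ae_itv phiP GP n; have := kernel_ae_itv psiP KP n.
  apply: filterS2 => t /andP[? ?] /andP[? ?].
  by rewrite /W ger0_norm; lra.
apply: (L1_cvg0_le _ (L1_cvg0D (kernel_L1 phiP GP) (kernel_L1 psiP KP))) => n.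
  apply: measurable_funB => //.
  exact: (measurable_int_pair (Xint n) (Yint n) (fun x y => mean2 (x, y))).
apply: aeW => t; rewrite [leRHS]ger0_norm ?addr_ge0//.
by apply: le_trans _ (ler_normD _ _); rewrite /W /mean2/= opprD addrACA.
Qed.

End two_kernels.
End conditional_limit.

(** * Spearman's rho and Kendall's tau *)

Section mid_distribution.
Context (R : realType) (d : measure_display) (T : measurableType d)
  (P : probability T R).

Lemma Rintegral_indic (A : set T) : measurable A ->
  \int[P]_t (\1_A t : R) = fine (P A).
Proof. by move=> mA; rewrite /Rintegral integral_indic// setIT. Qed.

Lemma fine_probability_setC (A : set T) : measurable A ->
  fine (P (~` A)) = 1 - fine (P A).
Proof. by move=> mA; rewrite probability_setC// fineB// fin_num_measure. Qed.

Lemma measurable_RV_lt (X : {RV P >-> R}) (k : R) : measurable [set s | X s < k].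
Proof.
rewrite (_ : [set s | _] = X @^-1` `]-oo, k[); first exact: measurable_funPTI.
by apply/seteqP; split=> s /=; rewrite in_itv.
Qed.

Lemma measurable_RV_le (X : {RV P >-> R}) (k : R) : measurable [set s | X s <= k].
Proof.
rewrite (_ : [set s | _] = X @^-1` `]-oo, k]); first exact: measurable_funPTI.
by apply/seteqP; split=> s /=; rewrite in_itv.
Qed.

Lemma measurable_RV_gt (X : {RV P >-> R}) (k : R) : measurable [set s | k < X s].
Proof.
rewrite (_ : [set s | _] = X @^-1` `]k, +oo[); first exact: measurable_funPTI.
by apply/seteqP; split=> s /=; rewrite in_itv/= andbT.
Qed.

Lemma measurable_RV_ge (X : {RV P >-> R}) (k : R) : measurable [set s | k <= X s].
Proof.
rewrite (_ : [set s | _] = X @^-1` `[k, +oo[); first exact: measurable_funPTI.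
by apply/seteqP; split=> s /=; rewrite in_itv/= andbT.
Qed.

Lemma probability_gt (X : {RV P >-> R}) (k : R) :
  fine (P [set s | k < X s]) = 1 - fine (P [set s | X s <= k]).
Proof.
rewrite -fine_probability_setC; last exact: measurable_RV_le.
congr (fine (P _)); apply/seteqP; split=> s /=; rewrite ltNge; first by move/negP.
by move/negP.
Qed.

Lemma probability_ge (X : {RV P >-> R}) (k : R) :
  fine (P [set s | k <= X s]) = 1 - fine (P [set s | X s < k]).
Proof.
rewrite -fine_probability_setC; last exact: measurable_RV_lt.
congr (fine (P _)); apply/seteqP; split=> s /=; rewrite leNgt; first by move/negP.
by move/negP.
Qed.

Lemma int_lt_le (X : {RV P >-> R}) (k : R) : integer_valued X ->
  k \is a Num.int -> [set s | X s < k] = [set s | X s <= k - 1].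
Proof.
move=> Xint /intrP[m ->]; apply/seteqP; split=> s /=;
  have /intrP[l ->] := Xint s.
  by rewrite ltr_int -[X in _ - X]/(1%:~R) -intrB ler_int; lia.
by rewrite ltr_int -[X in _ - X]/(1%:~R) -intrB ler_int; lia.
Qed.

(* Exchanging the two independent copies turns P(X' < X) into P(X < X'). *)
Lemma integral_probability_lt_gt (X : {RV P >-> R}) :
  (\int[P]_t P [set s | (X s < X t)%R] = \int[P]_t P [set s | (X t < X s)%R])%E.
Proof.
pose A := [set w : T * T | X w.2 < X w.1].
have mA : measurable A.
  rewrite (_ : A = setT `&` (fun w => X w.1 - X w.2) @^-1` `]0, +oo[).
    have m1 : measurable_fun setT (fun w : T * T => X w.1).
      by apply: (measurableT_comp (f := X)) => //; exact: measurable_fst.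
    have m2 : measurable_fun setT (fun w : T * T => X w.2).
      by apply: (measurableT_comp (f := X)) => //; exact: measurable_snd.
    by apply: (measurable_funB m1 m2).
  by rewrite setTI; apply/seteqP; split=> w /=; rewrite in_itv/= andbT subr_gt0.
have mf : measurable_fun setT (fun w => (\1_A w : R)%:E).
  by apply/measurable_EFinP; exact: measurable_indic.
(* The two orders of integration of the indicator of [A] give the two sides. *)
have := @fubini_tonelli _ _ _ _ R P P (fun w => (\1_A w : R)%:E) mf
  (fun w => eq_ind_r is_true (ler0n _ _) (lee_fin _ _)).
rewrite (_ : (fun t => \int[P]_s (\1_A (t, s) : R)%:E)%E =
  (fun t => P [set s | (X s < X t)%R])); last first.
  apply/funext => t; rewrite -(setIT [set s | (X s < X t)%R]) -integral_indic//.
  exact: measurable_RV_lt.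
rewrite (_ : (fun s => \int[P]_t (\1_A (t, s) : R)%:E)%E =
  (fun s => P [set t | (X s < X t)%R])) // .
apply/funext => s; rewrite -(setIT [set t | (X s < X t)%R]) -integral_indic//.
exact: measurable_RV_gt.
Qed.


Definition cdf_fun (X : T -> R) (k : R) : R := fine (P [set t | X t <= k]).

Let cdf_norm (X : T -> R) k : measurable [set t | X t <= k] -> `|cdf_fun X k| <= 1.
Proof.
move=> mX; rewrite ger0_norm ?fine_ge0// -lee_fin fineK ?fin_num_measure//.
exact: probability_le1.
Qed.

Let calF_cdf_norm (X : {RV P >-> R}) k : `|calF (cdf_fun X) k| <= 2.
Proof.
rewrite /calF (le_trans (ler_normD _ _))// (_ : 2 = 1 + 1)//.
by apply: lerD; apply: cdf_norm; exact: measurable_RV_le.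
Qed.

Section one_variable.
Variable X : {RV P >-> R}.
Hypothesis Xint : integer_valued X.

(** By integrality [F(X - 1)] is the probability, given [X], that an independent copy [X'] satisfies
    [X' < X]. By symmetry its mean is that of the probability of [X < X'], namely of [1 - F(X)]. *)
Lemma mean_calF_cdf : \int[P]_t calF (cdf_fun X) (X t) = 1.
Proof.
have icdf : P.-integrable setT (EFin \o (fun t => cdf_fun X (X t))).
  apply: (integrable_int_pair Xint Xint (h := fun p => cdf_fun X p.1) (M := 1)) => p.
  exact/cdf_norm/measurable_RV_le.
have icdf1 : P.-integrable setT (EFin \o (fun t => cdf_fun X (X t - 1))).
  apply: (integrable_int_pair Xint Xint
    (h := fun p => cdf_fun X (p.1 - 1)) (M := 1)) => p.
  exact/cdf_norm/measurable_RV_le.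
rewrite /calF RintegralD//.
have -> : \int[P]_t cdf_fun X (X t - 1) = \int[P]_t (1 - cdf_fun X (X t)).
  have := integral_probability_lt_gt X.
  rewrite (_ : (fun t => P [set s | (X s < X t)%R]) =
    (fun t => (cdf_fun X (X t - 1))%:E)); last first.
    apply/funext => t; rewrite int_lt_le// fineK// fin_num_measure//.
    exact: measurable_RV_le.
  rewrite (_ : (fun t => P [set s | (X t < X s)%R]) =
    (fun t => (1 - cdf_fun X (X t))%:E)); last first.
    apply/funext => t; rewrite -probability_gt fineK// fin_num_measure//.
    exact: measurable_RV_gt.
  by rewrite /Rintegral => ->.
rewrite RintegralB//; last exact: finite_measure_integrable_cst.
by rewrite Rintegral_probability_cst subrKC.
Qed.

End one_variable.

Variables X Y : {RV P >-> R}.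
Hypotheses (Xint : integer_valued X) (Yint : integer_valued Y).

(** With the first coordinate fixed at [t], the section of the event is the rectangle [A t] times
    [B t], so its probability factorises. *)
Let prod3 (A B : T -> set T) (a b : R -> R) :
  (forall t, measurable (A t)) -> (forall t, measurable (B t)) ->
  (forall t, fine (P (A t)) = a (X t)) -> (forall t, fine (P (B t)) = b (Y t)) ->
  fine ((P \x (P \x P))%E [set w | A w.1 w.2.1 /\ B w.1 w.2.2]) =
  \int[P]_t (a (X t) * b (Y t)).
Proof.
move=> mA mB aE bE; rewrite /product_measure1 /Rintegral; congr fine.
apply: eq_integral => t _ /=.
rewrite -aE -bE EFinM !fineK ?fin_num_measure// -product_measure1E//.
congr (product_measure1 _ _ _); apply/seteqP; split=> w.
  by move/xsectionP.
by move=> ?; apply/xsectionP.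
Qed.

(** The four products of [gt] and [ge] add up to [(2 - cX) (2 - cY)], where [cX] and [cY] are the
    [calF] variables. Both of these have mean 1, so after expansion the constant and linear terms
    cancel: [4 - 2 - 2 = 0]. *)
Lemma spearman_rhoE : spearman_rho X Y =
  3 * \int[P]_t (calF (cdf_fun X) (X t) * calF (cdf_fun Y) (Y t)) - 3.
Proof.
have sum4 (I : R) : 4 + - 2 * 1 + - 2 * 1 + I = I by lra.
have sub3 (I : R) : 3 * (I - 1) = 3 * I - 3 by lra.
pose gt V k := 1 - cdf_fun V k; pose ge V k := 1 - cdf_fun V (k - 1).
have mgt (V : {RV P >-> R}) t := measurable_RV_gt V (V t).
have mge (V : {RV P >-> R}) t := measurable_RV_ge V (V t).
have gtE (V : {RV P >-> R}) t : fine (P [set s | V t < V s]) = gt V (V t).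
  exact: probability_gt.
have geE (V : {RV P >-> R}) t : integer_valued V ->
    fine (P [set s | V t <= V s]) = ge V (V t).
  by move=> Vint; rewrite probability_ge int_lt_le.
have cdf1 (V : {RV P >-> R}) k : 0 <= cdf_fun V k <= 1.
  have := cdf_norm (measurable_RV_le V k).
  by rewrite ger0_norm ?fine_ge0// => ->.
have gt1 (V : {RV P >-> R}) k : `|gt V k| <= 1.
  by have /andP[? ?] := cdf1 V k; rewrite /gt ger0_norm; lra.
have ge1 (V : {RV P >-> R}) k : `|ge V k| <= 1 by exact: gt1.
have iM (a b : R -> R) : (forall k, `|a k| <= 1) -> (forall k, `|b k| <= 1) ->
    P.-integrable setT (EFin \o (fun t => a (X t) * b (Y t))).
  move=> a1 b1; apply: (integrable_int_pair Xint Yint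
    (h := fun p => a p.1 * b p.2) (M := 1)) => t.
  by rewrite normrM mulr_ile1.
pose ltS (V : T -> R) t := [set s | V t < V s].
pose leS (V : T -> R) t := [set s | V t <= V s].
pose Pr (A : set (T * (T * T))) := fine ((P \x (P \x P))%E A).
have p1 : Pr [set w | X w.1 < X w.2.1 /\ Y w.1 < Y w.2.2] =
    \int[P]_t (gt X (X t) * gt Y (Y t)).
  exact: (@prod3 (ltS X) (ltS Y) _ _ (mgt X) (mgt Y) (gtE X) (gtE Y)).
have p2 : Pr [set w | X w.1 <= X w.2.1 /\ Y w.1 < Y w.2.2] =
    \int[P]_t (ge X (X t) * gt Y (Y t)).
  exact: (@prod3 (leS X) (ltS Y) _ _ (mge X) (mgt Y) (geE X ^~ Xint) (gtE Y)).
have p3 : Pr [set w | X w.1 < X w.2.1 /\ Y w.1 <= Y w.2.2] =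
    \int[P]_t (gt X (X t) * ge Y (Y t)).
  exact: (@prod3 (ltS X) (leS Y) _ _ (mgt X) (mge Y) (gtE X) (geE Y ^~ Yint)).
have p4 : Pr [set w | X w.1 <= X w.2.1 /\ Y w.1 <= Y w.2.2] =
    \int[P]_t (ge X (X t) * ge Y (Y t)).
  exact: (@prod3 (leS X) (leS Y) _ _ (mge X) (mge Y) (geE X ^~ Xint) (geE Y ^~ Yint)).
suff : 3 * (\int[P]_t (gt X (X t) * gt Y (Y t)) +
    \int[P]_t (ge X (X t) * gt Y (Y t)) + \int[P]_t (gt X (X t) * ge Y (Y t)) +
    \int[P]_t (ge X (X t) * ge Y (Y t)) - 1) =
    3 * \int[P]_t (calF (cdf_fun X) (X t) * calF (cdf_fun Y) (Y t)) - 3.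
  by rewrite -p1 -p2 -p3 -p4; apply.
have i1 := iM _ _ (gt1 X) (gt1 Y); have i2 := iM _ _ (ge1 X) (gt1 Y).
have i3 := iM _ _ (gt1 X) (ge1 Y); have i4 := iM _ _ (ge1 X) (ge1 Y).
pose cX t := calF (cdf_fun X) (X t); pose cY t := calF (cdf_fun Y) (Y t).
have icX : P.-integrable setT (EFin \o cX).
  apply: (integrable_int_pair Xint Yint
    (h := fun p => calF (cdf_fun X) p.1) (M := 2)) => t.
  exact: calF_cdf_norm.
have icY : P.-integrable setT (EFin \o cY).
  apply: (integrable_int_pair Xint Yint
    (h := fun p => calF (cdf_fun Y) p.2) (M := 2)) => t.
  exact: calF_cdf_norm.
have icXY : P.-integrable setT (EFin \o (fun t => cX t * cY t)).
  apply: (integrable_int_pair Xint Yint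
    (h := fun p => calF (cdf_fun X) p.1
      * calF (cdf_fun Y) p.2) (M := 2 * 2)) => t.
  by rewrite normrM ler_pM//; exact: calF_cdf_norm.
have isum : \int[P]_t (gt X (X t) * gt Y (Y t)) + \int[P]_t (ge X (X t) * gt Y (Y t)) +
    \int[P]_t (gt X (X t) * ge Y (Y t)) + \int[P]_t (ge X (X t) * ge Y (Y t)) =
    \int[P]_t (cX t * cY t).
  have iD (f g : T -> R) : P.-integrable setT (EFin \o f) ->
      P.-integrable setT (EFin \o g) ->
      P.-integrable setT (EFin \o (fun t => f t + g t)).
    by move=> iF ig; apply: eq_integrable (integrableD _ iF ig).
  have iZ (k : R) (f : T -> R) : P.-integrable setT (EFin \o f) ->
      P.-integrable setT (EFin \o (fun t => k * f t)).
    by move=> iF; apply: eq_integrable (integrableZl _ k iF).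
  have icst (k : R) : P.-integrable setT (EFin \o (fun=> k)).
    exact: finite_measure_integrable_cst.
  rewrite -RintegralD// -RintegralD//; last exact: iD.
  rewrite -RintegralD//; last exact: (iD _ _ (iD _ _ i1 i2) i3).
  (* This is [(2 - cX) (2 - cY)] expanded, ready for integration term by term. *)
  transitivity (\int[P]_t (((4 + - 2 * cX t) + - 2 * cY t) + cX t * cY t)).
    by apply: eq_Rintegral => t _; rewrite /cX /cY /calF /gt /ge; ring.
  have iX2 := iZ (- 2) _ icX; have iY2 := iZ (- 2) _ icY; have ic4 := icst 4.
  rewrite RintegralD//; last exact: (iD _ _ (iD _ _ ic4 iX2) iY2).
  rewrite RintegralD//; last exact: (iD _ _ ic4 iX2).
  rewrite RintegralD// !RintegralZl// !mean_calF_cdf// Rintegral_probability_cst.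
  exact: sum4.
by rewrite isum sub3.
Qed.

End mid_distribution.

(** * Kernel means at integer thresholds are cdfs *)

Section step_cdf.
Context (R : realType) (d : measure_display) (T : measurableType d)
  (P : probability T R) (X Y : {RV P >-> R}).
Hypotheses (Xint : integer_valued X) (Yint : integer_valued Y).

Lemma step_indic (V : T -> R) (k : R) : integer_valued V -> k \is a Num.int ->
  (fun t => step k (V t)) = \1_[set t | V t <= k].
Proof.
move=> Vint ki; apply/funext => t; rewrite step_int// indicE.
by congr (nat_of_bool _)%:R; apply/idP/idP; rewrite inE.
Qed.

Lemma stepM_indic (k l : R) : k \is a Num.int -> l \is a Num.int ->
  (fun t => step k (X t) * step l (Y t)) = \1_[set t | X t <= k /\ Y t <= l].
Proof.
move=> ki li; apply/funext => t; rewrite !step_int// indicE -natrM mulnb.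
by congr (nat_of_bool _)%:R; apply/idP/idP; rewrite inE => /andP.
Qed.

Lemma kernel_mean_step1 (k l : R) : k \is a Num.int ->
  kernel_mean X Y (fun a _ p => step a p.1) k l = cdf_fun P X k.
Proof.
move=> ki; rewrite /kernel_mean step_indic// Rintegral_indic//.
exact: measurable_RV_le.
Qed.

Lemma kernel_mean_step2 (k l : R) : l \is a Num.int ->
  kernel_mean X Y (fun _ b p => step b p.2) k l = cdf_fun P Y l.
Proof.
move=> li; rewrite /kernel_mean step_indic// Rintegral_indic//.
exact: measurable_RV_le.
Qed.

Lemma kernel_mean_stepM (k l : R) : k \is a Num.int -> l \is a Num.int ->
  kernel_mean X Y (fun a b p => step a p.1 * step b p.2) k l = joint_cdf X Y k l.
Proof.
move=> ki li; rewrite /kernel_mean stepM_indic// Rintegral_indic//.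
by apply: (measurableI _ _ (measurable_RV_le X k) (measurable_RV_le Y l)).
Qed.

End step_cdf.

(** * Conditional and unconditional limits of the rank correlations *)

Theorem theorem3p1 (R : realType) (d d' : nat -> measure_display)
  (T : forall n, measurableType (d n)) (E : forall n, measurableType (d' n))
  (P : forall n, probability (T n) R)
  (X Y : forall n, {RV P n >-> R}) (Z : forall n, {RV P n >-> E n})
  (d0 : measure_display) (T0 : measurableType d0) (P0 : probability T0 R)
  (X0 Y0 : {RV P0 >-> R})
  (Xint : forall n, integer_valued (X n)) (Yint : forall n, integer_valued (Y n))
  (X0int : integer_valued X0) (Y0int : integer_valued Y0)
  (cvgXY : cvg_in_distribution_given X Y Z X0 Y0)
  (FX FY : forall n, R -> T n -> R) (H : forall n, R -> R -> T n -> R)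
  (FXP : forall n, cond_cdf_version (Z n) (X n) (FX n))
  (FYP : forall n, cond_cdf_version (Z n) (Y n) (FY n))
  (HP : forall n, cond_joint_cdf_version (Z n) (X n) (Y n) (H n)) :
  let FF n t := calF_at (FX n) (X n) t * calF_at (FY n) (Y n) t in
  let HH n t := calH_at (H n) (X n) (Y n) t in
  [/\ forall U : forall n, T n -> R,
        (forall n, condE_version (Z n) (FF n) (U n)) ->
        cvg_in_probability P (fun n t => 3 * U n t - 3) (spearman_rho X0 Y0),
      forall V : forall n, T n -> R,
        (forall n, condE_version (Z n) (HH n) (V n)) ->
        cvg_in_probability P (fun n t => V n t - 1) (kendall_tau X0 Y0),
      (3%:E * 'E_(P n)[FF n] - 3%:E)%E @[n --> \oo] --> (spearman_rho X0 Y0)%:E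
    & ('E_(P n)[HH n] - 1)%E @[n --> \oo] --> (kendall_tau X0 Y0)%:E].
Proof.
move=> FF HH.
have int1 (k : R) : k \is a Num.int -> k - 1 \is a Num.int.
  by move=> ki; apply: rpredB => //; exact: rpred1.
(* A kernel shifted in one threshold only carries an unsimplified [- 0] in the other. *)
have int0 (k : R) : k \is a Num.int -> k - 0 \is a Num.int by move=> ?; rewrite subr0.
pose phi1 (a _ : R) (p : R * R) := step a p.1.
pose phi2 (_ b : R) (p : R * R) := step b p.2.
pose phiM (a b : R) (p : R * R) := step a p.1 * step b p.2.
pose sh (u v : R) (phi : R -> R -> R * R -> R) := fun a b => phi (a - u) (b - v).
have k1 : lip_kernel phi1 by exact: lip_kernel_step1.
have k2 : lip_kernel phi2 by exact: lip_kernel_step2.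
have kM : lip_kernel phiM by exact: lip_kernel_stepM.
have s1 : lip_kernel (sh 1 0 phi1) by exact: lip_kernel_shift.
have s2 : lip_kernel (sh 0 1 phi2) by exact: lip_kernel_shift.
have M10 : lip_kernel (sh 1 0 phiM) by exact: lip_kernel_shift.
have M01 : lip_kernel (sh 0 1 phiM) by exact: lip_kernel_shift.
have M11 : lip_kernel (sh 1 1 phiM) by exact: lip_kernel_shift.
(* At integer thresholds the indicators equal the step functions, so the given conditional cdfs are
   versions for the Lipschitz kernels. *)
have FX1 n (k : R) : k \is a Num.int ->
    condE_version (Z n) (fun t => step k (X n t)) (FX n k).
  by move=> ki; rewrite (step_indic (@Xint n) ki); exact: FXP.
have FY1 n (k : R) : k \is a Num.int ->
    condE_version (Z n) (fun t => step k (Y n t)) (FY n k).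
  by move=> ki; rewrite (step_indic (@Yint n) ki); exact: FYP.
have H1 n (k l : R) : k \is a Num.int -> l \is a Num.int ->
    condE_version (Z n) (fun t => step k (X n t) * step l (Y n t)) (H n k l).
  by move=> ki li; rewrite (stepM_indic (@Xint n) (@Yint n) ki li); exact: HP.
have H10 n (k l : R) : k \is a Num.int -> l \is a Num.int ->
    condE_version (Z n) (fun t => sh 1 0 phiM k l (X n t, Y n t)) (H n (k - 1) l).
  by move=> ki li; rewrite /sh /phiM subr0; exact: H1 (int1 _ ki) li.
have H01 n (k l : R) : k \is a Num.int -> l \is a Num.int ->
    condE_version (Z n) (fun t => sh 0 1 phiM k l (X n t, Y n t)) (H n k (l - 1)).
  by move=> ki li; rewrite /sh /phiM subr0; exact: H1 ki (int1 _ li).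
(* Limits of the two [calF] factors and of the two halves of [calH]. From them come [hF] and [hH],
   the bounded continuous test functions to which the convergence hypothesis is applied. *)
pose h1 := mean2 X0 Y0 phi1 (sh 1 0 phi1).
pose h2 := mean2 X0 Y0 phi2 (sh 0 1 phi2).
pose g1 := mean2 X0 Y0 phiM (sh 1 0 phiM).
pose g2 := mean2 X0 Y0 (sh 0 1 phiM) (sh 1 1 phiM).
pose hF p := h1 p * h2 p; pose hH p := g1 p + g2 p.
have h1n p : `|h1 p| <= 2 by exact: mean2_norm.
have h2n p : `|h2 p| <= 2 by exact: mean2_norm.
have g1n p : `|g1 p| <= 2 by exact: mean2_norm.
have g2n p : `|g2 p| <= 2 by exact: mean2_norm.
have hFn p : `|hF p| <= 2 * 2 by rewrite normrM ler_pM.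
have hHn p : `|hH p| <= 2 + 2 by rewrite (le_trans (ler_normD _ _))// lerD.
have hFc : continuous hF by move=> p; apply: cvgM; exact: mean2_continuous.
have hHc : continuous hH by move=> p; apply: cvgD; exact: mean2_continuous.
have two := two_kernels_L1 Xint Yint X0int Y0int cvgXY.
(* Marginal versions are fed in as families with two thresholds that ignore one of them. *)
have [mX nX LX] := two _ _ k1 s1 (fun n k _ => FX n k) (fun n k _ => FX n (k - 1))
  (fun n k l ki li => FX1 n k ki) (fun n k l ki li => FX1 n _ (int1 k ki)).
have [mY nY LY] := two _ _ k2 s2 (fun n _ l => FY n l) (fun n _ l => FY n (l - 1))
  (fun n k l ki li => FY1 n l li) (fun n k l ki li => FY1 n _ (int1 l li)).
have [mA nA LA] := two _ _ kM M10 (fun n k l => H n k l) (fun n k l => H n (k - 1) l)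
  (fun n k l ki li => H1 n k l ki li)
  (fun n k l ki li => H10 n k l ki li).
have [mB nB LB] := two _ _ M01 M11 (fun n k l => H n k (l - 1))
  (fun n k l => H n (k - 1) (l - 1))
  (fun n k l ki li => H01 n k l ki li)
  (fun n k l ki li => H1 n _ _ (int1 k ki) (int1 l li)).
have mFF n : measurable_fun setT (FF n) by exact: measurable_funM.
have HHE n t : HH n t = (H n (X n t) (Y n t) t + H n (X n t - 1) (Y n t) t) +
    (H n (X n t) (Y n t - 1) t + H n (X n t - 1) (Y n t - 1) t).
  by rewrite /HH /calH_at /calH !addrA.
have mHH n : measurable_fun setT (HH n).
  by rewrite (funext (HHE n)); exact: measurable_funD.
have iFF n : (P n).-integrable setT (EFin \o FF n).
  apply: (@bounded_integrable _ _ _ (P n) _ (2 * 2)) => //.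
  by apply: filterS2 (nX n) (nY n) => t nXt nYt; rewrite normrM ler_pM.
have iHH n : (P n).-integrable setT (EFin \o HH n).
  apply: (@bounded_integrable _ _ _ (P n) _ (2 + 2)) => //.
  apply: filterS2 (nA n) (nB n) => t nAt nBt.
  by rewrite HHE (le_trans (ler_normD _ _))// lerD.
have mh n (h : R * R -> R) : measurable_fun setT (fun t => h (X n t, Y n t)).
  exact: (measurable_int_pair (@Xint n) (@Yint n) (fun x y => h (x, y))).
have LFF : L1_cvg0 P (fun n t => FF n t - hF (X n t, Y n t)).
  (* With [x] and [y] the two [calF] variables, [x y - h1 h2 = (x - h1) y + h1 (y - h2)]. The
     factors 2 bound [|y|], almost surely, and [|h1|]. *)
  apply: (L1_cvg0_le _ (L1_cvg0D (L1_cvg0Z 2 LX) (L1_cvg0Z 2 LY))) => n.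
    by apply: measurable_funB => //; exact: mh.
  apply: filterS (nY n) => t nYt; rewrite [leRHS]ger0_norm ?addr_ge0//.
  rewrite -/h1 -/h2 /FF /hF /calF_at /calF.
  set x := FX n _ _ + _; set y := FY n _ _ + _ in nYt *.
  rewrite (_ : _ - _ = (x - h1 (X n t, Y n t)) * y + h1 (X n t, Y n t) *
    (y - h2 (X n t, Y n t))); last by ring.
  rewrite (le_trans (ler_normD _ _))// !normrM mulrC (ger0_norm (ler0n _ 2)).
  by rewrite lerD// ler_wpM2r.
have LHH : L1_cvg0 P (fun n t => HH n t - hH (X n t, Y n t)).
  apply: (L1_cvg0_le _ (L1_cvg0D LA LB)) => n.
    by apply: measurable_funB => //; exact: mh.
  apply: aeW => t; rewrite [leRHS]ger0_norm ?addr_ge0//.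
  by apply: le_trans _ (ler_normD _ _); rewrite HHE /hH opprD addrACA.
(* Since [X0] and [Y0] are integer valued, [h1] and [h2] are evaluated only where they coincide with
   [calF] of the limit cdfs. *)
have rhoE : spearman_rho X0 Y0 = 3 * \int[P0]_t hF (X0 t, Y0 t) - 3.
  rewrite spearman_rhoE//; congr (3 * _ - 3); apply: eq_Rintegral => t _.
  have Xt := X0int t; have Yt := Y0int t.
  rewrite /hF; have -> : h1 (X0 t, Y0 t) = calF (cdf_fun P0 X0) (X0 t).
    exact: congr2 (kernel_mean_step1 Y0 X0int (Y0 t) Xt)
      (kernel_mean_step1 Y0 X0int (Y0 t - 0) (int1 _ Xt)).
  have -> // : h2 (X0 t, Y0 t) = calF (cdf_fun P0 Y0) (Y0 t).
  exact: congr2 (kernel_mean_step2 X0 Y0int (X0 t) Yt)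
    (kernel_mean_step2 X0 Y0int (X0 t - 0) (int1 _ Yt)).
have tauE : kendall_tau X0 Y0 = \int[P0]_t hH (X0 t, Y0 t) - 1.
  rewrite /kendall_tau unlock; congr (fine _ - 1); apply: eq_integral => t _.
  have Xt := X0int t; have Yt := Y0int t.
  pose J := joint_cdf X0 Y0; pose x := X0 t; pose y := Y0 t.
  have stepE := kernel_mean_stepM X0int Y0int.
  have g1E : g1 (x, y) = J x y + J (x - 1) (y - 0).
    exact: congr2 (stepE _ _ Xt Yt) (stepE _ _ (int1 _ Xt) (int0 _ Yt)).
  have g2E : g2 (x, y) = J (x - 0) (y - 1) + J (x - 1) (y - 1).
    exact: congr2 (stepE _ _ (int0 _ Xt) (int1 _ Yt))
      (stepE _ _ (int1 _ Xt) (int1 _ Yt)).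
  by rewrite /hH g1E g2E !subr0 addrA.
split.
- move=> U UP; rewrite rhoE; apply: L1_cvg0_cvgP.
  rewrite (_ : (fun n t => _) =
      fun n t => 3 * (U n t - \int[P0]_t hF (X0 t, Y0 t))); last first.
    by apply: functional_extensionality_dep => n; apply/funext => t; ring.
  exact: L1_cvg0Z (condE_cvg_L1 Xint Yint cvgXY hFc hFn iFF LFF UP).
- move=> V VP; rewrite tauE; apply: L1_cvg0_cvgP.
  rewrite (_ : (fun n t => _) =
      fun n t => V n t - \int[P0]_t hH (X0 t, Y0 t)); last first.
    by apply: functional_extensionality_dep => n; apply/funext => t; ring.
  exact: (condE_cvg_L1 Xint Yint cvgXY hHc hHn iHH LHH VP).
(* The unconditional limits use the L1 closeness of [FF] and [HH] to the test functions directly,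
   with no version of their conditional expectations. *)
- rewrite rhoE EFinB EFinM; apply: cvgeB => //; last exact: cvg_cst.
  apply: cvgeZl => //; rewrite unlock.
  exact: (integral_cvg_L1 Xint Yint cvgXY hFc hFn iFF LFF).
- rewrite tauE EFinB; apply: cvgeB => //; last exact: cvg_cst.
  rewrite unlock.
  exact: (integral_cvg_L1 Xint Yint cvgXY hHc hHn iHH LHH).
Qed.
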